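(* Let $W$ and $W^*$ be random variables defined on the same probability space such that $E(Wf(W))=Ef'(W^* )$ for all bounded absolutely continuous $f$ with bounded derivative $f'$. Assume that $EW=0$, $EW^2=1$ and $|W-W^*|\le\delta$ for some constant $\delta$. Then $$\frac{P(W\ge x)}{1-\Phi(x)}=1+O(1)(1+x^3)\delta$$ for $0\le x\le\delta^{-1/3}$.
   Context: $\Phi$ is the standard normal distribution function. $O(1)$ denotes a quantity whose absolute value is bounded by an absolute (universal) constant. (If $W^*$ satisfies the displayed identity, its distribution is called the $W$-zero-biased distribution.) *)

(* Defs.v *)
From HB Require Import structures.
From mathcomp Require Import all_boot all_order all_algebra.
From mathcomp Require Import all_classical all_reals all_analysis.
Set Implicit Arguments.
Unset Strict Implicit.
Unset Printing Implicit Defensive.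
Import Order.TTheory GRing.Theory Num.Theory.
Import numFieldNormedType.Exports.
Local Open Scope classical_set_scope.
Local Open Scope ring_scope.

Definition abs_continuous_on (R : realType) (a b : R) (f : R -> R) : Prop :=
  forall e : R, 0 < e -> exists2 d : R, 0 < d &
    forall (n : nat) (u v : 'I_n -> R),
      (forall i, [/\ a <= u i, u i <= v i & v i <= b]) ->
      trivIset [set: 'I_n] (fun i => `]u i, v i[%classic) ->
      \sum_(i < n) (v i - u i) < d ->
      \sum_(i < n) `|f (v i) - f (u i)| < e.

(* On the whole line, absolute continuity means absolute continuity on every
   compact interval. *)
Definition abs_continuous (R : realType) (f : R -> R) : Prop :=
  forall a b : R, abs_continuous_on a b f.

(* The derivative of an absolutely continuous function exists only almost
   everywhere: g is any version of f', i.e. it equals f' at each point where f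
   is derivable and is arbitrary (but measurable) on the remaining null set. *)
Definition derivative_version (R : realType) (f g : R -> R) : Prop :=
  measurable_fun [set: R] g /\ forall x, derivable f x 1 -> g x = f^`()%classic x.

(* Ws has the W-zero-biased distribution, with the variance of W equal to 1. *)
Definition zero_bias_identity (R : realType) (d : measure_display) (T : measurableType d)
    (P : probability T R) (W Ws : {RV P >-> R}) : Prop :=
  forall f g : R -> R,
    abs_continuous f -> bounded_fun f ->
    derivative_version f g -> bounded_fun g ->
    ('E_P[fun t => (W t * f (W t))%R] = 'E_P[fun t => g (Ws t)])%E.

Definition Phi (R : realType) (x : R) : R := fine (normal_prob 0 1 `]-oo, x]%classic).

(* Main.v *)
Require Import Defs.
From HB Require Import structures.
From mathcomp Require Import all_boot all_order all_algebra.
From mathcomp Require Import all_classical all_reals all_analysis.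
From mathcomp Require Import measurable_realfun ring lra.
Import Order.TTheory GRing.Theory Num.Theory.
Import numFieldNormedType.Exports.
Local Open Scope classical_set_scope.
Local Open Scope ring_scope.

(** The proof compares [Ws], rather than [W], with the normal law, because the
zero bias identity gives the tail of [Ws] exactly.  Write T for the normal tail
[gtail], phi for the density and M = T / phi for the Mills ratio.  For a
threshold y the function f given by f(w) = T(y) M(- w) for w < y and
f(w) = (1 - T(y)) M(w) for w >= y solves Stein's equation
f'(w) = w f(w) + T(y) - 1(y <= w).  Feeding it to the identity
E[W f(W)] = E[f'(Ws)] yields

   P(Ws >= y) - T(y) = E[Ws f(Ws)] - E[W f(W)],

and since |W - Ws| <= delta the right-hand side is at most delta times the
expectation of a local bound on the derivative of w f(w).  By the two classical
bounds on the Mills ratio ([mills_lower], [mills_upper]) this derivative is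
O(T(y)) (1 + m^2) exp(m^2 / 2), where m is w truncated to [0, y]
([xstein_left'_le], [xstein_right'_le]).

So everything rests on E[(1 + m^2) exp(m^2 / 2)] = O(1 + y^3) for m the
truncation of W ([expected_weight_le]).  On each interval [j - 1, j] the
function exp(m^2 / 2) is bounded by a constant times exp(j m - j^2 / 2), so the
estimate follows by summing j^2 over j <= y + 1, once
E[exp(u min(W, y))] = O(exp(u^2 / 2)) is known for u <= y + 1.  That in turn
comes from the zero bias identity applied to exp(u min(w, y)): the expectation
h(u) satisfies h' <= u exp(u delta) h, hence
h(u) = O(exp(exp(u delta) u^2 / 2)), and u^3 delta is bounded in the range
considered ([truncated_mgf_le], [mgf_exponent_le]).  Together this is
[zero_bias_tail]: P(Ws >= y) = T(y) (1 + O(1 + y^3) delta).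

Finally P(Ws >= x + delta) <= P(W >= x) <= P(Ws >= x - delta), and
phi(x) <= 2 (1 + x) T(x) shows that moving the argument of T by delta costs a
factor 1 + O(1 + x) delta only.  Because x - delta may be slightly negative,
thresholds y >= -1 are allowed throughout.  If delta > 1 then x <= 1 and the
bound is trivial. *)

(** * Calculus of functions with a kink *)

Section Calculus.
Context {R : realType}.
Implicit Types (f F G : R -> R) (c x u v L : R).

Lemma is_derive_increment f (df : R -> R) u v L : u <= v ->
  (forall w : R, u <= w <= v -> is_derive w 1 f (df w)) ->
  (forall w, u <= w <= v -> `|df w| <= L) ->
  `|f v - f u| <= L * (v - u).
Proof.
move=> uv fd dfL.
have [w|w|c] := @MVT_segment R f df u v uv.
- by rewrite in_itv/= => /andP[/ltW uw /ltW wv]; apply: fd; rewrite uw.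
- apply: derivable_within_continuous => z; rewrite in_itv/= => zuv.
  by have [] := fd _ zuv.
rewrite in_itv/= => cuv ->.
by rewrite normrM ler_pM// ?dfL// ger0_norm// subr_ge0.
Qed.

Lemma is_derive_le0_nincr f (df : R -> R) u v : u <= v ->
  (forall w : R, u <= w <= v -> is_derive w 1 f (df w)) ->
  (forall w, u <= w <= v -> df w <= 0) -> f v <= f u.
Proof.
move=> uv fd df0.
have [w|w|c] := @MVT_segment R f df u v uv.
- by rewrite in_itv/= => /andP[/ltW uw /ltW wv]; apply: fd; rewrite uw.
- apply: derivable_within_continuous => z; rewrite in_itv/= => zuv.
  by have [] := fd _ zuv.
rewrite in_itv/= => cuv E.
by rewrite -subr_le0 E mulr_le0_ge0 ?df0// subr_ge0.
Qed.

Lemma lipschitz_abs_continuous f L :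
  (forall u v, u <= v -> `|f v - f u| <= L * (v - u)) -> abs_continuous f.
Proof.
move=> fL a b e e0; exists (e / (`|L| + 1)).
  by rewrite divr_gt0// ltr_wpDl.
move=> n u v uv _; rewrite ltr_pdivlMr ?ltr_wpDl//; apply: le_lt_trans.
rewrite mulr_suml ler_sum// => i _; have [_ uvi _] := uv i.
rewrite (le_trans (fL _ _ uvi))// mulrC ler_wpM2l ?subr_ge0//.
by rewrite (le_trans (ler_norm _))// lerDl.
Qed.

Lemma bounded_fun_le f : (exists M, forall x, `|f x| <= M) -> bounded_fun f.
Proof.
move=> [M fM]; exists M; split; first exact: num_real.
by move=> N MN x _ /=; rewrite (le_trans (fM x))// ltW.
Qed.

(** The test functions below have a kink, where they may or may not be derivable.
If they are, the derivative must agree with the one computed from the right, so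
right derivatives always form an admissible version of the derivative. *)
Lemma derive1_right f F x c e : 0 < e -> derivable f x 1 ->
  is_derive x 1 F c -> (forall h, 0 <= h -> h < e -> f (x + h) = F (x + h)) ->
  f^`()%classic x = c.
Proof.
move=> e0 df [dF <-] fF; rewrite derive1E.
have qf := cvg_dnbhs_at_right df.
have qF := cvg_dnbhs_at_right dF.
apply: cvg_unique qf _ => //.
apply: cvg_trans qF; apply: near_eq_cvg; near=> h => /=.
have h0 : 0 < h by [].
have he : h < e by near: h; exact: nbhs_right_lt.
have -> : h%:A = h := mulr1 h.
have f0 : f x = F x by have := fF 0 (lexx 0) e0; rewrite addr0.
by rewrite [h + x]addrC f0 fF// ltW.
Unshelve. all: by end_near. Qed.

Definition glue c F1 F2 : R -> R := fun w => if w < c then F1 w else F2 w.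

(** A Lipschitz bound is read off the two pieces by passing through the point c,
where they agree. *)
Lemma glue_increment c F1 F2 G1 G2 u v L :
  (forall w : R, is_derive w 1 F1 (G1 w)) -> (forall w : R, is_derive w 1 F2 (G2 w)) ->
  F1 c = F2 c -> u <= v ->
  (forall w, u <= w <= v -> w <= c -> `|G1 w| <= L) ->
  (forall w, u <= w <= v -> c <= w -> `|G2 w| <= L) ->
  `|glue c F1 F2 v - glue c F1 F2 u| <= L * (v - u).
Proof.
move=> dF1 dF2 F12 uv G1L G2L; rewrite /glue.
have [vc|cv] := ltP v c.
  rewrite (le_lt_trans uv vc); apply: is_derive_increment => // w uwv.
  by rewrite G1L//; case/andP: uwv => _ /le_trans; apply; exact: ltW.
have [uc|cu] := ltP u c; last first.
  apply: is_derive_increment => // w uwv.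
  by rewrite G2L//; case/andP: uwv => + _; apply: le_trans.
have -> : F2 v - F1 u = (F2 v - F2 c) + (F1 c - F1 u) by rewrite F12; ring.
have -> : L * (v - u) = L * (v - c) + L * (c - u) by ring.
rewrite (le_trans (ler_normD _ _))// lerD//.
  apply: is_derive_increment => // w /andP[cw wv].
  by rewrite G2L// wv (le_trans (ltW uc)).
apply: (@is_derive_increment F1 G1) => // [|w /andP[uw wc]]; first exact: ltW.
by rewrite G1L// uw (le_trans wc).
Qed.

Lemma measurable_glue c F1 F2 : measurable_fun setT F1 ->
  measurable_fun setT F2 -> measurable_fun setT (glue c F1 F2).
Proof.
by move=> mF1 mF2; apply: measurable_fun_ifT => //; exact: measurable_fun_ltr.
Qed.

Lemma glue_derivative_version c F1 F2 G1 G2 :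
  (forall w : R, is_derive w 1 F1 (G1 w)) -> (forall w : R, is_derive w 1 F2 (G2 w)) ->
  measurable_fun setT G1 -> measurable_fun setT G2 ->
  derivative_version (glue c F1 F2) (glue c G1 G2).
Proof.
move=> dF1 dF2 mG1 mG2; split; first exact: measurable_glue.
move=> w df; rewrite {1}/glue; have [wc|cw] := ltP w c; apply/esym.
  apply: (@derive1_right _ F1 _ _ (c - w)) => // [|h _ hcw].
    by rewrite subr_gt0.
  by rewrite /glue addrC -ltrBrDr hcw.
apply: (@derive1_right _ F2 _ _ 1) => // h h0 _.
by rewrite /glue ltNge (le_trans cw)// lerDl.
Qed.

End Calculus.

(** * Mills ratio of the normal law *)

(** The rules for sums and products restated for explicit lambda abstractions, so
that they apply up to conversion to formulas in a bound variable. *)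
Section DerivativeRules.
Context {R : realType}.
Implicit Types (f g : R -> R) (a b w : R).

Lemma is_derive1M f g w a b : is_derive w 1 f a -> is_derive w 1 g b ->
  is_derive w 1 (fun v => f v * g v) (a * g w + f w * b).
Proof.
by move=> fa gb; apply: is_derive_eq (is_deriveM fa gb) _; rewrite addrC mulrC.
Qed.

Lemma is_derive1D f g w a b : is_derive w 1 f a -> is_derive w 1 g b ->
  is_derive w 1 (fun v => f v + g v) (a + b).
Proof. by move=> fa gb; exact: (is_deriveD fa gb). Qed.

Lemma is_derive1B f g w a b : is_derive w 1 f a -> is_derive w 1 g b ->
  is_derive w 1 (fun v => f v - g v) (a - b).
Proof. by move=> fa gb; exact: (is_deriveB fa gb). Qed.

Lemma is_derive1V f w a : f w != 0 -> is_derive w 1 f a ->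
  is_derive w 1 (fun v => (f v)^-1) (- (f w ^- 2 * a)).
Proof.
by move=> f0 fa; apply: is_derive_eq (is_deriveV f0 fa) _; rewrite -mulNr.
Qed.

Lemma is_derive1_reflect f w a : is_derive (- w) 1 f a ->
  is_derive w 1 (fun v => f (- v)) (- a).
Proof.
move=> fa.
have := @is_derive1_comp R f -%R w a (-1) fa (is_deriveNid w 1).
by rewrite mulrN1.
Qed.

Lemma is_derive1_sqr w : is_derive w 1 (fun v : R => v ^+ 2) (2 * w).
Proof.
have := is_derive1M _ _ _ _ _ (@is_derive_id R R w 1) (@is_derive_id R R w 1).
move=> H; have -> : (fun v : R => v ^+ 2) = (fun v => id v * id v) by [].
by apply: is_derive_eq H _; rewrite /=; ring.
Qed.

Lemma is_derive1_continuous f (df : R -> R) :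
  (forall w : R, is_derive w 1 f (df w)) -> continuous f.
Proof.
move=> fd w; apply: differentiable_continuous; apply/derivable1_diffP.
by have [] := fd w.
Qed.

Lemma is_derive1_measurable f (df : R -> R) :
  (forall w : R, is_derive w 1 f (df w)) -> measurable_fun setT f.
Proof.
by move=> fd; apply: continuous_measurable_fun; exact: is_derive1_continuous fd.
Qed.

End DerivativeRules.

Section Gaussian.
Context {R : realType}.
Implicit Types (u v w : R).

Definition gdensity w : R := normal_pdf 0 1 w.
Definition gtail w : R := 1 - Phi w.
Definition mills w : R := gtail w / gdensity w.

Let idR : measurableTypeR R -> R := idfun.

#[local] HB.instance Definition _ :=
  @isMeasurableFun.Build _ _ _ _ idR (@measurable_id _ _ setT).

Let nP : probability (measurableTypeR R) R := normal_prob 0 1.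

Let PhiE w : (Phi w)%:E = cdf (idR : {RV nP >-> R}) w.
Proof.
rewrite /cdf /distribution /= /pushforward preimage_id /Phi fineK//.
exact: (@fin_num_measure _ _ _ nP).
Qed.

Lemma gtail_ge0 w : 0 <= gtail w.
Proof. by rewrite subr_ge0 -lee_fin PhiE cdf_le1. Qed.

Lemma gtail_le1 w : gtail w <= 1.
Proof. by rewrite lerBlDr lerDl -lee_fin PhiE cdf_ge0. Qed.

Lemma gtail_small e : 0 < e -> exists A, forall w, A <= w -> gtail w < e.
Proof.
move=> e0; have := @cvg_cdfy1 _ _ _ nP (idR : {RV nP >-> R}).
rewrite -(_ : EFin \o (@Phi R) = cdf (idR : {RV nP >-> R})); last first.
  by apply/funext => w /=; rewrite PhiE.
move=> /fine_cvgP[_] /cvgrPdist_lt /(_ e e0)[A [_ H]].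
exists (A + 1) => w Aw; rewrite (le_lt_trans (ler_norm _))//.
by apply: H; rewrite (lt_le_trans _ Aw)// ltrDl.
Qed.

Lemma gtailN_large e : 0 < e -> exists A, forall w, A <= w -> 1 - e < gtail (- w).
Proof.
move=> e0; have := @cvg_cdfNy0 _ _ _ nP (idR : {RV nP >-> R}).
rewrite -(_ : EFin \o (@Phi R) = cdf (idR : {RV nP >-> R})); last first.
  by apply/funext => w /=; rewrite PhiE.
move=> /fine_cvgP[_] /cvgrPdist_lt /(_ e e0)[A [_ H]].
exists (- A + 1) => w Aw; rewrite ltrD2l ltrN2.
rewrite (le_lt_trans (ler_norm _))// -normrN -sub0r.
by apply: H; rewrite ltrNl (lt_le_trans _ Aw)// ltrDl.
Qed.

Lemma gdensityE w : gdensity w = normal_peak 1 * expR (- (w ^+ 2 / 2)).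
Proof.
rewrite /gdensity normal_pdfE ?oner_neq0// /normal_fun subr0 expr1n.
by rewrite -mulr_natr mul1r mulNr.
Qed.

Lemma normal_peak1_gt0 : 0 < normal_peak (1 : R).
Proof. by rewrite normal_peak_gt0 ?oner_neq0. Qed.

Lemma gdensity_gt0 w : 0 < gdensity w.
Proof. by rewrite gdensityE mulr_gt0 ?expR_gt0 ?normal_peak1_gt0. Qed.

Lemma gdensity_neq0 w : gdensity w != 0.
Proof. by rewrite gt_eqF ?gdensity_gt0. Qed.

Lemma gdensity_le w : gdensity w <= normal_peak 1.
Proof. by rewrite /gdensity normal_pdf_ub// oner_neq0. Qed.

Lemma gdensityN w : gdensity (- w) = gdensity w.
Proof. by rewrite !gdensityE sqrrN. Qed.

Lemma is_derive_gdensity w : is_derive w 1 gdensity (- w * gdensity w).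
Proof.
have -> : gdensity = (fun v => cst (normal_peak 1) v * expR (- (v ^+ 2 / 2))).
  by apply/funext => v; rewrite gdensityE.
have dq : is_derive w 1 (fun v : R => - (v ^+ 2 / 2)) (- w).
  have -> : (fun v : R => - (v ^+ 2 / 2)) = (fun v => v ^+ 2 * cst (- 2^-1) v).
    by apply/funext => v /=; rewrite mulrN.
  apply: is_derive_eq (is_derive1M _ _ _ _ _ (is_derive1_sqr w)
    (is_derive_cst (- 2^-1 : R) w 1)) _.
  by rewrite /=; field.
have de := @is_derive1_comp R expR _ w _ _ (is_derive_expR _) dq.
apply: is_derive_eq (is_derive1M _ _ _ _ _ (is_derive_cst _ w 1) de) _.
by rewrite /=; ring.
Qed.

Lemma is_derive_gtail w : is_derive w 1 gtail (- gdensity w).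
Proof.
have [dP PE] : derivable (@Phi R) w 1 /\ (@Phi R)^`()%classic w = gdensity w.
  apply: (@continuous_FTC1 R gdensity -oo%O w (w + 1)) => //.
  - by rewrite ltrDl.
  - by apply: integrableS (integrable_normal_pdf 0 1) => //.
  - by rewrite ltNyr.
  - exact: (@continuous_normal_pdf R 0 1 (oner_neq0 R) w).
have dPhi : is_derive w 1 (@Phi R) (gdensity w).
  by split => //; rewrite -derive1E.
apply: is_derive_eq (is_derive1B _ _ _ _ _ (is_derive_cst (1 : R) w 1) dPhi) _.
by rewrite sub0r.
Qed.

Lemma gtail_nincr u v : u <= v -> gtail v <= gtail u.
Proof.
move=> uv; apply: (is_derive_le0_nincr _ _ _ _ uv (fun w _ => is_derive_gtail w)).
by move=> w _; rewrite oppr_le0 ltW ?gdensity_gt0.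
Qed.

(** The derivative of T(- v) + T(v) vanishes by symmetry of the density, and this
function tends to 1. *)
Lemma gtailN w : gtail (- w) = 1 - gtail w.
Proof.
pose D v := gtail (- v) + gtail v.
have dD v : is_derive v 1 D 0.
  have dN := is_derive1_reflect _ _ _ (is_derive_gtail (- v)).
  apply: is_derive_eq (is_derive1D _ _ _ _ _ dN (is_derive_gtail v)) _.
  by rewrite gdensityN opprK subrr.
have cD u v : D u = D v.
  wlog uv : u v / u <= v.
    by move=> H; have [/H|/ltW/H] := leP u v.
  apply/eqP; rewrite eq_sym -subr_eq0 -normr_le0.
  rewrite (le_trans (is_derive_increment D (fun=> 0) u v 0 uv _ _)) ?mul0r//.
  by move=> _ _; rewrite normr0.
suff : D w = 1 by rewrite /D => <-; rewrite addrK.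
apply/eqP; rewrite eq_le; apply/andP; split; apply/ler_addgt0Pr => e e0.
  have [A HA] := gtail_small _ e0.
  by rewrite (cD w A) lerD ?gtail_le1// ltW// HA.
have [A HA] := gtailN_large _ e0.
rewrite (cD w A) -lerBlDr (le_trans (ltW (HA A (lexx A))))// lerDl.
exact: gtail_ge0.
Qed.

Lemma is_derive_mills w : is_derive w 1 mills (w * mills w - 1).
Proof.
have dV := is_derive1V _ _ _ (gdensity_neq0 w) (is_derive_gdensity w).
apply: is_derive_eq (is_derive1M _ _ _ _ _ (is_derive_gtail w) dV) _.
by rewrite /mills; field; exact: gdensity_neq0.
Qed.

Lemma mills_ge0 w : 0 <= mills w.
Proof. by rewrite divr_ge0 ?gtail_ge0// ltW ?gdensity_gt0. Qed.

(** T(v) - v phi(v) / (1 + v^2) is nonincreasing, and it is at least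
- phi(v) / v for v > 0, which tends to 0; hence it is nonnegative. *)
Lemma mills_lower w : w <= (1 + w ^+ 2) * mills w.
Proof.
have p1 (v : R) : 0 < 1 + v ^+ 2 by rewrite ltr_pwDl// sqr_ge0.
pose D v := gtail v - v * gdensity v * (1 + v ^+ 2)^-1.
pose dD v : R := - (2 * gdensity v / (1 + v ^+ 2) ^+ 2).
have DdD (v : R) : is_derive v 1 D (dD v).
  have d1 := is_derive1M _ _ _ _ _ (@is_derive_id R R v 1) (is_derive_gdensity v).
  have d2 := is_derive1D _ _ _ _ _ (is_derive_cst (1 : R) v 1) (is_derive1_sqr v).
  have d2V := is_derive1V (fun z => 1 + z ^+ 2) _ _ (lt0r_neq0 (p1 v)) d2.
  have d3 := is_derive1M _ _ _ _ _ d1 d2V.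
  apply: is_derive_eq (is_derive1B _ _ _ _ _ (is_derive_gtail v) d3) _.
  rewrite /dD /=; field; exact: lt0r_neq0.
have D0 : 0 <= D w.
  apply/ler_addgt0Pr => e e0.
  (* beyond this point phi(v) / v is at most e, since phi is at most its peak *)
  pose v := Num.max w (Num.max 1 (normal_peak 1 / e)).
  have wv : w <= v by rewrite /v le_max lexx.
  have v1 : 1 <= v by rewrite /v !le_max lexx orbT.
  have ve : normal_peak 1 / e <= v by rewrite /v !le_max lexx !orbT.
  have v0 : 0 < v by exact: lt_le_trans v1.
  have DD : D v <= D w.
    apply: (is_derive_le0_nincr _ _ _ _ wv (fun v _ => DdD v)) => z _.
    by rewrite oppr_le0 divr_ge0 ?sqr_ge0// mulr_ge0// ltW ?gdensity_gt0.
  rewrite -lerBlDr sub0r (le_trans _ DD)// /D -[leLHS]add0r lerD ?gtail_ge0//.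
  rewrite lerN2 ler_pdivrMr ?p1//.
  have ge : gdensity v <= v * e.
    by rewrite (le_trans (gdensity_le v))// -ler_pdivrMr.
  have := ler_wpM2l (ltW v0) ge; have := sqr_ge0 v; nra.
rewrite /mills mulrA ler_pdivlMr ?gdensity_gt0// mulrC [leRHS]mulrC.
rewrite -ler_pdivrMr ?p1// mulrC -subr_ge0.
by move: D0; rewrite /D [v in v * _]mulrC mulrC.
Qed.

(** phi(v) / v - T(v) is nonincreasing on v > 0 and at least - T(v), which tends
to 0. *)
Lemma mills_upper w : 0 <= w -> w * mills w <= 1.
Proof.
rewrite le_eqVlt => /predU1P[<-|w0]; first by rewrite mul0r.
pose D v := gdensity v * v^-1 - gtail v.
pose dD v : R := - (gdensity v / v ^+ 2).
have DdD (v : R) : 0 < v -> is_derive v 1 D (dD v).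
  move=> v0; have v0' := lt0r_neq0 v0.
  have dV := is_derive1V _ _ _ v0' (@is_derive_id R R v 1).
  have d1 := is_derive1M _ _ _ _ _ (is_derive_gdensity v) dV.
  apply: is_derive_eq (is_derive1B _ _ _ _ _ d1 (is_derive_gtail v)) _.
  by rewrite /dD /=; field.
suff D0 : 0 <= D w.
  rewrite /mills mulrA ler_pdivrMr ?gdensity_gt0// mul1r mulrC.
  by rewrite -ler_pdivlMr// -subr_ge0.
apply/ler_addgt0Pr => e e0; have [A HA] := gtail_small _ e0.
pose v := Num.max w A.
have wv : w <= v by rewrite /v le_max lexx.
have v0 : 0 < v by exact: lt_le_trans wv.
have DD : D v <= D w.
  apply: (is_derive_le0_nincr _ dD _ _ wv) => z /andP[wz _].
    by apply: DdD; exact: lt_le_trans wz.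
  by rewrite oppr_le0 divr_ge0 ?sqr_ge0// ltW ?gdensity_gt0.
rewrite -lerBlDr sub0r (le_trans _ DD)// /D -[leLHS]add0r lerD//.
  by rewrite divr_ge0// ltW// gdensity_gt0.
by rewrite lerN2 ltW// HA// /v le_max lexx orbT.
Qed.

(** The derivative of M is w M(w) - 1, which is nonpositive by the upper bound. *)
Lemma mills_nincr u v : u <= v -> mills v <= mills u.
Proof.
move=> uv; apply: (is_derive_le0_nincr _ _ _ _ uv (fun w _ => is_derive_mills w)).
move=> w _; rewrite subr_le0; have [/mills_upper//|/ltW w0] := leP 0 w.
by rewrite (le_trans (mulr_le0_ge0 w0 (mills_ge0 w))).
Qed.

Lemma mills1_ge : 2^-1 <= mills 1.
Proof. by have := mills_lower 1; rewrite expr1n; lra. Qed.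

Lemma gtail_gt0 w : 0 < gtail w.
Proof.
have m : 0 < mills (Num.max w 1).
  have v0 : 1 <= Num.max w 1 by rewrite le_max lexx orbT.
  have := mills_lower (Num.max w 1); have := mills_ge0 (Num.max w 1).
  rewrite le_eqVlt => /predU1P[<-|//]; rewrite mulr0 => /(le_trans v0).
  by rewrite ler10.
have : 0 < gtail (Num.max w 1).
  by rewrite -[gtail _](divfK (gdensity_neq0 (Num.max w 1))) mulr_gt0 ?gdensity_gt0.
by move/lt_le_trans; apply; apply: gtail_nincr; rewrite le_max lexx.
Qed.

Lemma gtail_ge_half w : w <= 0 -> 2^-1 <= gtail w.
Proof.
move=> w0; rewrite (le_trans _ (gtail_nincr _ _ w0))//.
by have := gtailN 0; rewrite oppr0; lra.
Qed.

Lemma millsN_le w : mills (- w) <= (normal_peak 1)^-1 * expR (w ^+ 2 / 2).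
Proof.
rewrite /mills gdensityN gdensityE expRN.
move: (normal_peak 1) normal_peak1_gt0 => p p0; rewrite invfM invrK.
rewrite -[leRHS]mul1r ler_wpM2r ?gtail_le1// mulr_ge0 ?expR_ge0//.
by rewrite invr_ge0 ltW.
Qed.

(** The lower Mills bound makes the defect nonnegative.  For w >= 1 the upper bound
M(w) <= 1 / w makes it at most 1 / w; on [-1, 1] monotonicity of M suffices. *)
Lemma mills_defect_le w : -1 <= w ->
  `|(1 + w ^+ 2) * mills w - w| <= 2 * mills (-1) + 1.
Proof.
move=> w1; rewrite ger0_norm ?subr_ge0 ?mills_lower//.
have [w_gt1|w_le1] := ltP 1 w.
  have w0 : 0 < w by exact: lt_trans w_gt1.
  have m1 := mills_upper _ (ltW w0).
  have mm := mills_nincr _ _ w1.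
  have := ler_wpM2l (ltW w0) m1; have := mills_ge0 (-1); rewrite mulr1; nra.
have m1 := mills_nincr _ _ w1.
have q : w ^+ 2 <= 1 by nra.
have := mills_ge0 w; have := mills_ge0 (-1); nra.
Qed.

Lemma mills_inv_le w : 0 <= w -> 1 <= 2 * (1 + w) * mills w.
Proof.
move=> w0; have m0 := mills_ge0 w; have [w1|/ltW w1] := leP w 1.
  have := mills_nincr _ _ w1; have := mills1_ge; nra.
have := mills_lower w => L.
have : w * 1 <= w * ((1 + w) * mills w) by nra.
by rewrite ler_pM2l ?(lt_le_trans _ w1)//; nra.
Qed.

Lemma mills_sqr_ge w : 0 <= w -> 2^-1 <= (1 + w ^+ 2) * mills w.
Proof.
move=> w0; have m0 := mills_ge0 w; have [w1|/ltW w1] := leP w 1.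
  have := mills_nincr _ _ w1; have := mills1_ge; have := sqr_ge0 w; nra.
by rewrite (le_trans _ (mills_lower w))//; lra.
Qed.

End Gaussian.

(** * Expectations and the zero bias identity *)

Section ProbabilityTools.
Context {R : realType} {d} {T : measurableType d} {P : probability T R}.
Implicit Types (X Y : T -> R).

Lemma bounded_integrable X M : measurable_fun setT X ->
  (forall t, `|X t| <= M) -> P.-integrable setT (EFin \o X).
Proof.
move=> mX XM; apply: measurable_bounded_integrable => //.
  by rewrite (le_lt_trans (probability_le1 P measurableT))// ltry.
exists M; split; first exact: num_real.
by move=> N MN t _ /=; rewrite (le_trans (XM t))// ltW.
Qed.

Lemma integrable_dominated X Y : measurable_fun setT X ->
  (forall t, `|X t| <= `|Y t|) -> P.-integrable setT (EFin \o Y) ->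
  P.-integrable setT (EFin \o X).
Proof.
move=> mX XY; apply: le_integrable => //; first exact/measurable_EFinP.
by move=> t _ /=; rewrite lee_fin XY.
Qed.

Lemma integrable_measurable X : P.-integrable setT (EFin \o X) ->
  measurable_fun setT X.
Proof. by move=> /integrableP[/measurable_EFinP]. Qed.

Lemma integrable_cst (a : R) : P.-integrable setT (EFin \o (fun _ : T => a)).
Proof. exact: (@finite_measure_integrable_cst _ _ _ P). Qed.

Lemma integrable_add X Y : P.-integrable setT (EFin \o X) ->
  P.-integrable setT (EFin \o Y) ->
  P.-integrable setT (EFin \o (fun t => X t + Y t)).
Proof. by move=> iX iY; exact: (integrableD measurableT iX iY). Qed.

Lemma integrable_sub X Y : P.-integrable setT (EFin \o X) ->
  P.-integrable setT (EFin \o Y) ->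
  P.-integrable setT (EFin \o (fun t => X t - Y t)).
Proof. by move=> iX iY; exact: (integrableB measurableT iX iY). Qed.

Lemma integrable_scale (a : R) X : P.-integrable setT (EFin \o X) ->
  P.-integrable setT (EFin \o (fun t => a * X t)).
Proof. by move=> iX; exact: (integrableZl measurableT a iX). Qed.

Lemma integrable_mul_bounded X Y M : P.-integrable setT (EFin \o X) ->
  measurable_fun setT Y -> (forall t, `|Y t| <= M) ->
  P.-integrable setT (EFin \o (fun t => X t * Y t)).
Proof.
move=> iX mY YM; apply: (integrable_dominated _ (fun t => M * X t)).
- by apply: measurable_funM => //; exact: integrable_measurable.
- move=> t; rewrite !normrM mulrC ler_wpM2r// (le_trans (YM t))// ler_norm//.
- exact: integrable_scale.
Qed.

(** Replacing X by min(X, Y) does not change its integral and turns the almost sure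
inequality into a pointwise one. *)
Lemma ae_le_Rintegral X Y : P.-integrable setT (EFin \o X) ->
  P.-integrable setT (EFin \o Y) -> {ae P, forall t, X t <= Y t} ->
  \int[P]_t X t <= \int[P]_t Y t.
Proof.
move=> iX iY XY.
have mX := integrable_measurable _ iX; have mY := integrable_measurable _ iY.
pose Z t := Num.min (X t) (Y t).
have mZ : measurable_fun setT Z by exact: measurable_minr.
have iZ : P.-integrable setT (EFin \o Z).
  apply: (integrable_dominated _ (fun t => `|X t| + `|Y t|)) => //.
    move=> t; rewrite [leRHS]ger0_norm ?addr_ge0// /Z.
    by case: (leP (X t) (Y t)) => _; rewrite ?lerDl ?lerDr.
  by apply: integrable_add; exact: integrable_norm.
have -> : \int[P]_t X t = \int[P]_t Z t.
  congr fine; apply: ae_eq_integral => //; try exact/measurable_EFinP.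
  by apply: filterS XY => t tXY _ /=; rewrite /Z min_l.
by apply: le_Rintegral => // t _; rewrite /Z ge_min lexx orbT.
Qed.

Lemma Rintegral_sum n (X : 'I_n -> T -> R) :
  (forall i, P.-integrable setT (EFin \o X i)) ->
  P.-integrable setT (EFin \o (fun t => \sum_(i < n) X i t)) /\
  \int[P]_t (\sum_(i < n) X i t) = \sum_(i < n) \int[P]_t X i t.
Proof.
elim: n X => [X _|n IHn X iX].
  have E : (fun t => \sum_(i < 0) X i t) = fun=> 0.
    by apply/funext => t; rewrite big_ord0.
  rewrite E big_ord0; split; first exact: integrable_cst.
  by rewrite Rintegral_cst// mul0r.
have [iS ES] := IHn (fun i => X (widen_ord (leqnSn n) i)) (fun i => iX _).
have -> : (fun t => \sum_(i < n.+1) X i t) =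
    (fun t => \sum_(i < n) X (widen_ord (leqnSn n) i) t + X ord_max t).
  by apply/funext => t; rewrite big_ord_recr.
by rewrite big_ord_recr /= RintegralD// ES; split => //; exact: integrable_add.
Qed.

Lemma Rintegral_probability_cst (a : R) : \int[P]_t (fun _ : T => a) t = a.
Proof. by have := expectation_cst P a; rewrite unlock /Rintegral => ->. Qed.

Lemma measurable_ge_event (Y : {RV P >-> R}) (y : R) :
  measurable [set t | y <= Y t].
Proof.
have -> : [set t | y <= Y t] = setT `&` Y @^-1` `[y, +oo[%classic.
  by apply/seteqP; split=> t; rewrite /= in_itv/= andbT; [|case].
by apply: measurable_funP => //; exact: measurable_itv.
Qed.

Lemma Rintegral_event (A : set T) (mA : measurable A) :
  \int[P]_t (\1_A t) = fine (P A).
Proof. by rewrite /Rintegral integral_indic// setIT. Qed.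

End ProbabilityTools.

Section ZeroBias.
Context {R : realType} {d} {T : measurableType d} {P : probability T R}.
Variables (W Ws : {RV P >-> R}).

Hypothesis zbW : zero_bias_identity W Ws.

(** The form in which the zero bias identity is used: at a kink any value of the
derivative is admissible, and the right derivative is chosen, so that the jump
of the Stein solution produces the closed half-line [y, +oo[. *)
Lemma zero_bias_glue (c B L : R) (F1 F2 G1 G2 : R -> R) :
  (forall w : R, is_derive w 1 F1 (G1 w)) ->
  (forall w : R, is_derive w 1 F2 (G2 w)) -> F1 c = F2 c ->
  measurable_fun setT G1 -> measurable_fun setT G2 ->
  (forall w, w <= c -> `|F1 w| <= B) -> (forall w, c <= w -> `|F2 w| <= B) ->
  (forall w, w <= c -> `|G1 w| <= L) -> (forall w, c <= w -> `|G2 w| <= L) ->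
  \int[P]_t (W t * glue c F1 F2 (W t)) = \int[P]_t glue c G1 G2 (Ws t).
Proof.
move=> dF1 dF2 F12 mG1 mG2 F1B F2B G1L G2L.
have := zbW (glue c F1 F2) (glue c G1 G2).
rewrite unlock /Rintegral => -> //.
- apply: (lipschitz_abs_continuous _ L) => u v uv.
  by apply: (glue_increment c F1 F2 G1 G2) => // w _; [exact: G1L|exact: G2L].
- apply: bounded_fun_le; exists B => w; rewrite /glue.
  by case: (ltP w c) => wc; [exact/F1B/ltW|exact: F2B].
- exact: glue_derivative_version.
- apply: bounded_fun_le; exists L => w; rewrite /glue.
  by case: (ltP w c) => wc; [exact/G1L/ltW|exact: G2L].
Qed.

End ZeroBias.

(** * Exponential moments *)

Section Gronwall.
Context {R : realType}.

(** The hypothesis is an integrated form of h' <= a u h.  Cut [0, t] into n equal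
steps: each multiplies h by at most (1 - v)^-1 <= exp(v + 2 v^2), where v is of
order k / n^2 at step k.  The first order terms sum up to a t^2 / 2 + O(1 / n),
the squares to O(1 / n), and the constant 2 absorbs these errors.  Working with
increments avoids differentiating an expectation in a parameter. *)
Lemma gronwall_quadratic (h : R -> R) (a t : R) : 0 <= a -> 0 <= t ->
  (forall s, 0 <= h s) -> h 0 <= 1 ->
  (forall s u, 0 <= s -> s <= u -> u <= t ->
     h u - h s <= (u - s) * (a * u) * h u) ->
  h t <= expR (2 + a * t ^+ 2 / 2).
Proof.
move=> a0 t0 h0 h1 hstep; pose b := a * t ^+ 2.
have b0 : 0 <= b by rewrite mulr_ge0// sqr_ge0.
(* large enough for v <= 1/2 and for both error terms to be bounded by 1 *)
pose n := (Num.truncn (2 * b + 2 * b ^+ 2)).+1.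
have nb : 2 * b + 2 * b ^+ 2 < n%:R by rewrite truncnS_gt.
have n0 : 0 < n%:R :> R by rewrite ltr0n.
have nn0 : n%:R != 0 :> R by rewrite gt_eqF.
pose beta := b / n%:R.
have bE : b = beta * n%:R by rewrite /beta divfK.
have beta0 : 0 <= beta by rewrite divr_ge0// ltW.
have beta_half : beta <= 2^-1.
  by rewrite ler_pdivrMr//; have := sqr_ge0 b; nra.
have beta_sqr : 2 * beta ^+ 2 * n%:R <= 1.
  rewrite (_ : 2 * beta ^+ 2 * n%:R = 2 * b ^+ 2 / n%:R); last by rewrite /beta; field.
  by rewrite ler_pdivrMr// mul1r; nra.
pose u k := t * k%:R / n%:R.
pose E k := beta / n%:R * (k%:R * (k%:R + 1) / 2) + 2 * beta ^+ 2 * k%:R.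
have uE : forall k, (k <= n)%N -> h (u k) <= expR (E k).
  elim=> [_|k IHk kn].
    by rewrite /u /E !(mulr0, mul0r) addr0 expR0.
  have {}IHk := IHk (ltnW kn).
  have u0 j : 0 <= u j by rewrite !mulr_ge0 ?invr_ge0 ?ler0n.
  have ut : u k.+1 <= t.
    by rewrite ler_pdivrMr// ler_wpM2l// ler_nat.
  have uu : u k <= u k.+1.
    by rewrite ler_pM2r ?invr_gt0// ler_wpM2l// ler_nat.
  have := hstep _ _ (u0 k) uu ut.
  pose v := beta / n%:R * (k%:R + 1).
  have -> : (u k.+1 - u k) * (a * u k.+1) = v.
    by rewrite /u /v /beta /b -(@natr1 _ k); field.
  move=> hv; have v0 : 0 <= v by rewrite mulr_ge0 ?divr_ge0 ?addr_ge0 ?ler0n// ltW.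
  have vb : v <= beta.
    rewrite /v mulrAC ler_pdivrMr// ler_wpM2l//.
    by rewrite natr1 ler_nat.
  have EE : E k.+1 = E k + (v + 2 * beta ^+ 2).
    by rewrite /E /v -(@natr1 _ k); field.
  have e1 : 1 <= (1 - v) * expR (v + 2 * beta ^+ 2).
    have ex := expR_ge1Dx (v + 2 * beta ^+ 2).
    have v1 : 0 <= 1 - v by rewrite subr_ge0; lra.
    apply: le_trans (ler_wpM2l v1 ex).
    by nra.
  have hk0 := h0 (u k.+1).
  rewrite EE expRD (le_trans (ler_peMr hk0 e1))// mulrA ler_wpM2r ?expR_ge0//.
  by apply: le_trans IHk; lra.
have := uE n (leqnn n); rewrite {1}/u mulfK// => /le_trans; apply.
rewrite ler_expR -/b /E bE.
have -> : beta / n%:R * (n%:R * (n%:R + 1) / 2) = beta * n%:R / 2 + beta / 2.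
  by field.
lra.
Qed.

End Gronwall.

Section MomentGeneratingFunction.
Context {R : realType} {d} {T : measurableType d} {P : probability T R}.
Variables (W Ws : {RV P >-> R}) (delta : R).

Hypothesis zbW : zero_bias_identity W Ws.
Hypothesis iW : P.-integrable setT (EFin \o (W : T -> R)).
Hypothesis delta_ge0 : 0 <= delta.
Hypothesis near_coupling : {ae P, forall t, `|W t - Ws t| <= delta}.

Definition truncated_mgf (A u : R) : R :=
  \int[P]_t (expR (u * Num.min (W t) A)).

Lemma measurable_truncated_exp (X : {RV P >-> R}) (A u : R) :
  measurable_fun setT (fun t => expR (u * Num.min (X t) A)).
Proof.
apply: measurableT_comp => //; apply: measurable_funM => //.
exact: measurable_minr.
Qed.

Lemma truncated_exp_bound (A u w : R) : 0 <= u ->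
  `|expR (u * Num.min w A)| <= expR (u * A).
Proof.
move=> u0; rewrite ger0_norm ?expR_ge0// ler_expR ler_wpM2l//.
by rewrite ge_min lexx orbT.
Qed.

Lemma integrable_truncated_exp (X : {RV P >-> R}) (A u : R) : 0 <= u ->
  P.-integrable setT (EFin \o (fun t => expR (u * Num.min (X t) A))).
Proof.
move=> u0; apply: (bounded_integrable _ (expR (u * A))).
  exact: measurable_truncated_exp.
by move=> t; exact: truncated_exp_bound.
Qed.

(** Testing the identity against exp (u min(w, A)) gives
E[W exp(u min(W, A))] <= u E[exp(u min(Ws, A))], and the coupling replaces Ws
by W at the price of a factor exp(u delta). *)
Lemma zero_bias_exp (A u : R) : 0 <= A -> 0 <= u ->
  \int[P]_t (W t * expR (u * Num.min (W t) A)) <=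
    u * expR (u * delta) * truncated_mgf A u.
Proof.
move=> A0 u0.
pose F1 (w : R) := expR (u * w); pose G1 (w : R) := u * expR (u * w).
have dF1 (w : R) : is_derive w 1 F1 (G1 w).
  have dl : is_derive w 1 (fun v => cst u v * id v) u.
    apply: is_derive_eq (is_derive1M _ _ _ _ _ (is_derive_cst u w 1)
      (@is_derive_id R R w 1)) _.
    by rewrite /=; ring.
  apply: is_derive_eq (@is_derive1_comp R expR _ w _ _ (is_derive_expR _) dl) _.
  by rewrite /G1 /= mulrC.
have dF2 (w : R) : is_derive w 1 (cst (expR (u * A))) ((cst 0 : R -> R) w).
  exact: is_derive_cst.
have F1A w : w <= A -> F1 w <= expR (u * A).
  by move=> wA; rewrite ler_expR ler_wpM2l.
have glueE w : glue A F1 (cst (expR (u * A))) w = expR (u * Num.min w A).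
  by rewrite /glue /F1 /=; case: (ltP w A).
have := @zero_bias_glue R d T P W Ws zbW A (expR (u * A)) (u * expR (u * A))
  F1 (cst (expR (u * A))) G1 (cst 0) dF1 dF2 erefl.
under eq_Rintegral do rewrite glueE.
move=> ->; first last.
- by move=> w _; rewrite normr0 mulr_ge0// expR_ge0.
- move=> w wA; rewrite ger0_norm; last by rewrite mulr_ge0// expR_ge0.
  by rewrite ler_wpM2l// F1A.
- by move=> w _; rewrite ger0_norm// expR_ge0.
- by move=> w wA; rewrite ger0_norm ?expR_ge0// F1A.
- by [].
- by apply: measurable_funM => //; exact: measurableT_comp.
rewrite /truncated_mgf -RintegralZl//; last exact: integrable_truncated_exp.
apply: ae_le_Rintegral.
- apply: (bounded_integrable _ (u * expR (u * A))).
    apply: measurableT_comp => //.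
    apply: measurable_fun_ifT => //; first exact: measurable_fun_ltr.
    by apply: measurable_funM => //; exact: measurableT_comp.
  move=> t; rewrite /glue; case: (ltP (Ws t) A) => wA.
    rewrite ger0_norm; last by rewrite mulr_ge0// expR_ge0.
    by rewrite ler_wpM2l// F1A// ltW.
  by rewrite normr0 mulr_ge0// expR_ge0.
- by apply: integrable_scale; exact: integrable_truncated_exp.
- apply: filterS near_coupling => t; rewrite ler_distlC => /andP[_ H1].
  rewrite /glue; case: (ltP (Ws t) A) => wA; last first.
    by rewrite !mulr_ge0// expR_ge0.
  rewrite -mulrA ler_wpM2l// -expRD ler_expR -mulrDr ler_wpM2l//.
  case: (leP (W t) A) => _; first by rewrite addrC.
  by rewrite (le_trans (ltW wA))// lerDr.
Qed.

(** By convexity exp(u Y) - exp(s Y) <= (u - s) Y exp(u Y), and Y = min(W, A) is at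
most W; the expectation of W exp(u Y) is bounded by the previous lemma. *)
Lemma truncated_mgf_step (A s u : R) : 0 <= A -> 0 <= s -> s <= u ->
  truncated_mgf A u - truncated_mgf A s <=
    (u - s) * (u * expR (u * delta)) * truncated_mgf A u.
Proof.
move=> A0 s0 su; have u0 := le_trans s0 su.
have i1 := integrable_truncated_exp W A u u0.
have i2 := integrable_truncated_exp W A s s0.
have i3 : P.-integrable setT
    (EFin \o (fun t => W t * expR (u * Num.min (W t) A))).
  apply: (integrable_mul_bounded _ _ (expR (u * A))) => //.
    exact: measurable_truncated_exp.
  by move=> t; exact: truncated_exp_bound.
rewrite -mulrA.
apply: le_trans (ler_wpM2l _ (zero_bias_exp _ _ A0 u0)); last by rewrite subr_ge0.
rewrite -RintegralB// -RintegralZl//; apply: le_Rintegral => //.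
- exact: integrable_sub.
- exact: integrable_scale.
move=> t _; set Y := Num.min (W t) A.
have YW : Y <= W t by rewrite /Y ge_min lexx.
have E : expR (s * Y) = expR (u * Y) * expR (- (u - s) * Y).
  by rewrite -expRD; congr expR; ring.
have := expR_ge1Dx (- (u - s) * Y); rewrite E.
have eu := expR_ge0 (u * Y); have us : 0 <= u - s by rewrite subr_ge0.
move=> /(ler_wpM2l eu) H1.
have := ler_wpM2l us (ler_wpM2r eu YW).
by nra.
Qed.

Lemma truncated_mgf_le (A u : R) : 0 <= A -> 0 <= u ->
  truncated_mgf A u <= expR (2 + expR (u * delta) * u ^+ 2 / 2).
Proof.
move=> A0 u0; apply: gronwall_quadratic => //.
- by move=> s; apply: Rintegral_ge0 => t _; exact: expR_ge0.
- rewrite /truncated_mgf; under eq_Rintegral do rewrite mul0r expR0.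
  by rewrite Rintegral_probability_cst.
move=> s v s0 sv vu; apply: (le_trans (truncated_mgf_step _ _ _ A0 s0 sv)).
have v0 := le_trans s0 sv.
rewrite ler_wpM2r//.
  by apply: Rintegral_ge0 => t _; exact: expR_ge0.
rewrite ler_wpM2l ?subr_ge0// mulrC ler_wpM2r// ler_expR.
by rewrite ler_wpM2r.
Qed.

End MomentGeneratingFunction.

(** * The expected Gaussian weight *)

Section Weight.
Context {R : realType}.
Implicit Types (m w X delta : R).

Definition clamp X w : R := Num.max 0 (Num.min w X).

(** Up to a factor O(T(y)), with y the threshold, the value of this function at
[clamp y w] bounds the derivative of w f(w) for the Stein solution f. *)
Definition weight m : R := (1 + m ^+ 2) * expR (m ^+ 2 / 2).

Lemma clamp_ge0 X w : 0 <= clamp X w.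
Proof. by rewrite /clamp le_max lexx. Qed.

Lemma clamp_le X w : 0 <= X -> clamp X w <= X.
Proof. by move=> X0; rewrite /clamp ge_max X0 ge_min lexx orbT. Qed.

Lemma clamp_homo X v w : v <= w -> clamp X v <= clamp X w.
Proof.
move=> vw; rewrite /clamp ge_max !le_max lexx /= !le_min !ge_min vw lexx.
by rewrite orbT /= orbT.
Qed.

Lemma clamp_shift X w delta : 0 <= delta ->
  clamp X (w + delta) <= clamp X w + delta.
Proof.
move=> d0; rewrite {1}/clamp ge_max addr_ge0 ?clamp_ge0//= ge_min.
have [wX|/ltW Xw] := leP w X; apply/orP; [left|right].
  by rewrite lerD2r /clamp le_max le_min lexx wX orbT.
by rewrite (@le_trans _ _ (clamp X w)) ?lerDl// /clamp le_max le_min lexx Xw orbT.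
Qed.

Lemma weight_ge1 m : 1 <= weight m.
Proof.
rewrite /weight -[leLHS]mul1r ler_pM//; first by rewrite lerDl sqr_ge0.
by rewrite -expR0 ler_expR divr_ge0 ?sqr_ge0.
Qed.

Lemma weight_homo m1 m2 : 0 <= m1 -> m1 <= m2 -> weight m1 <= weight m2.
Proof.
move=> m0 mm; have mm2 : m1 ^+ 2 <= m2 ^+ 2 by rewrite !expr2 ler_pM.
rewrite /weight ler_pM ?expR_ge0 ?addr_ge0 ?sqr_ge0// ?lerD2l//.
by rewrite ler_expR ler_wpM2r.
Qed.

(** Shifting m <= X by delta adds m delta + delta^2 / 2 to the exponent, and
X delta <= (1 + X^3) delta is bounded. *)
Lemma weight_shift X w delta : 0 <= X -> 0 <= delta -> delta <= 1 ->
  X ^+ 3 * delta <= 8 ->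
  weight (clamp X (w + delta)) <= 3 * expR 10 * weight (clamp X w).
Proof.
move=> X0 d0 d1 Xd.
apply: le_trans (weight_homo _ _ (clamp_ge0 _ _) (clamp_shift X w _ d0)) _.
have m0 := clamp_ge0 X w; have mX := clamp_le _ w X0.
move: (clamp X w) m0 mX => m m0 mX.
rewrite /weight mulrACA -expRD ler_pM ?expR_ge0 ?addr_ge0 ?sqr_ge0//.
  by have := sqr_ge0 (m - delta); nra.
have X1 : X <= 1 + X ^+ 3.
  have := sqr_ge0 (X - 1); have := mulr_ge0 X0 (sqr_ge0 (X - 1)); nra.
have := ler_wpM2r d0 X1; have := ler_wpM2r d0 mX.
by rewrite ler_expR; nra.
Qed.

(** If m lies in [j, j + 1] then
exp (m^2 / 2) = exp ((j + 1) m - (j + 1)^2 / 2 + (j + 1 - m)^2 / 2), so on each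
unit interval the Gaussian weight is an exponential up to a bounded factor.
Bounding it interval by interval, instead of integrating the derivative of the
weight against the tail of W, is what gives X^3 rather than X^4 in
[expected_weight_le]. *)
Lemma weight_le_sum_exp X w n : 0 <= X -> X < n%:R ->
  weight (clamp X w) <= 1 + \sum_(j < n)
    (1 + j.+1%:R ^+ 2) * expR (2^-1 - j.+1%:R ^+ 2 / 2) *
      expR (j.+1%:R * Num.min w X).
Proof.
move=> X0 Xn; pose F m (j : 'I_n) : R :=
  (1 + j.+1%:R ^+ 2) * expR (2^-1 - j.+1%:R ^+ 2 / 2) * expR (j.+1%:R * m).
rewrite -[X in _ <= 1 + X]/(\sum_(j < n) F (Num.min w X) j).
have F0 m j : 0 <= F m j by rewrite !mulr_ge0 ?expR_ge0// addr_ge0 ?sqr_ge0.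
have [w0|/ltW w0] := leP w 0.
  rewrite (_ : clamp X w = 0) ?/weight ?expr0n ?addr0 ?mul0r ?expR0 ?mul1r.
    by rewrite lerDl sumr_ge0.
  by apply: max_l; rewrite ge_min w0.
have m0 : 0 <= Num.min w X by rewrite le_min w0.
have mX : Num.min w X <= X by rewrite ge_min lexx orbT.
rewrite /clamp max_r//; move: (Num.min w X) m0 mX => m m0 mX.
have /andP[jm mj] := truncn_itv m0.
have jn : (Num.truncn m < n)%N.
  by rewrite -(ltr_nat R) (le_lt_trans jm)// (le_lt_trans mX).
rewrite (bigD1 (Ordinal jn))//= addrCA -[leLHS]addr0 lerD//; last first.
  by rewrite addr_ge0// sumr_ge0.
rewrite /F /= -[leRHS]mulrA -expRD /weight; move: mj jm; rewrite -natr1.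
move: (Num.truncn m)%:R (ler0n R (Num.truncn m)) => j j0 mj jm.
rewrite ler_pM ?expR_ge0 ?addr_ge0 ?sqr_ge0//.
  by rewrite lerD2l !expr2 ler_pM// ltW.
rewrite ler_expR; have : (j + 1 - m) ^+ 2 <= 1 by nra.
by nra.
Qed.

(** The factor exp (u delta) of the moment bound costs u^3 delta in the
exponent, which is bounded in the range of moderate deviations. *)
Lemma mgf_exponent_le X u delta : 0 <= X -> 0 <= u -> u <= X + 1 ->
  0 <= delta -> delta <= 1 -> X ^+ 3 * delta <= 8 ->
  expR (u * delta) * u ^+ 2 / 2 <= 18 * expR 37 + u ^+ 2 / 2.
Proof.
move=> X0 u0 uX d0 d1 Xd.
(* convexity of the cube *)
have u3 : u ^+ 3 <= 4 * (X ^+ 3 + 1).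
  have H : u ^+ 3 <= (X + 1) ^+ 3 by rewrite lerXn2r ?nnegrE ?addr_ge0.
  apply: (le_trans H); rewrite -subr_ge0.
  have -> : 4 * (X ^+ 3 + 1) - (X + 1) ^+ 3 = 3 * ((X - 1) ^+ 2 * (X + 1)) by ring.
  by rewrite mulr_ge0// mulr_ge0 ?sqr_ge0// addr_ge0.
have u3d : u ^+ 3 * delta <= 36 by have := ler_wpM2r d0 u3; lra.
have ud : u * delta <= 37.
  have u1 : u <= 1 + u ^+ 3.
    have := sqr_ge0 (u - 1); have := mulr_ge0 u0 (sqr_ge0 (u - 1)); nra.
  by have := ler_wpM2r d0 u1; lra.
have e37 : expR (u * delta) <= expR 37 by rewrite ler_expR.
have e1 : expR (u * delta) - 1 <= u * delta * expR (u * delta).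
  have := ler_wpM2l (expR_ge0 (u * delta)) (expR_ge1Dx (- (u * delta))).
  by rewrite expRN mulfV ?gt_eqF ?expR_gt0//; lra.
have ee := expR_ge0 (u * delta).
have H1 := ler_wpM2r (sqr_ge0 u) e1.
have d3 : 0 <= u ^+ 3 * delta by rewrite mulr_ge0// exprn_ge0.
have H2 : u ^+ 3 * delta * expR (u * delta) <= 36 * expR 37 by rewrite ler_pM.
have H3 : u * delta * expR (u * delta) * u ^+ 2 =
  u ^+ 3 * delta * expR (u * delta) by ring.
by rewrite H3 in H1; lra.
Qed.

Lemma measurable_weight_clamp X : measurable_fun setT (fun w => weight (clamp X w)).
Proof.
have mc : measurable_fun setT (clamp X).
  by apply: measurable_maxr => //; exact: measurable_minr.
have m2 : measurable_fun setT (fun w => clamp X w ^+ 2) by exact: measurable_funX.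
apply: measurable_funM; first exact: measurable_funD.
by apply: measurableT_comp => //; exact: measurable_funM.
Qed.

End Weight.

Section ExpectedWeight.
Context {R : realType} {d} {T : measurableType d} {P : probability T R}.
Lemma integrable_weight (X : R) (Y : {RV P >-> R}) : 0 <= X ->
  P.-integrable setT (EFin \o (fun t => weight (clamp X (Y t)))).
Proof.
move=> X0; apply: (bounded_integrable _ (weight X)).
  exact: (measurableT_comp (measurable_weight_clamp X)).
move=> t; rewrite ger0_norm; last by rewrite (le_trans _ (weight_ge1 _)).
by rewrite weight_homo ?clamp_ge0 ?clamp_le.
Qed.

Variables (W Ws : {RV P >-> R}) (delta X : R).

Hypothesis zbW : zero_bias_identity W Ws.
Hypothesis iW : P.-integrable setT (EFin \o (W : T -> R)).
Hypothesis delta_ge0 : 0 <= delta.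
Hypothesis delta_le1 : delta <= 1.
Hypothesis near_coupling : {ae P, forall t, `|W t - Ws t| <= delta}.
Hypothesis X_ge0 : 0 <= X.
Hypothesis X_moderate : X ^+ 3 * delta <= 8.

Lemma expected_weight_le :
  \int[P]_t weight (clamp X (W t)) <=
    (1 + 10 * expR (3 + 18 * expR 37)) * (1 + X ^+ 3).
Proof.
pose n := (Num.truncn X).+1.
have Xn : X < n%:R by rewrite truncnS_gt.
have nX : n%:R <= X + 1 by rewrite -natr1 lerD2r truncn_le.
pose c (j : 'I_n) : R := (1 + j.+1%:R ^+ 2) * expR (2^-1 - j.+1%:R ^+ 2 / 2).
have c0 j : 0 <= c j by rewrite mulr_ge0 ?expR_ge0// addr_ge0 ?sqr_ge0.
pose f (j : 'I_n) t := c j * expR (j.+1%:R * Num.min (W t) X).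
have iE (j : 'I_n) := integrable_truncated_exp W X _ (ler0n R j.+1).
have iF (j : 'I_n) : P.-integrable setT (EFin \o f j) by exact: integrable_scale.
have [iS ES] := Rintegral_sum _ f iF.
have i1 := @integrable_cst R d T P 1.
pose K : R := 2 + 18 * expR 37.
have term (j : 'I_n) : \int[P]_t f j t <= (1 + n%:R ^+ 2) * expR (K + 1).
  rewrite /f RintegralZl//.
  have jn : j.+1%:R <= n%:R :> R by rewrite ler_nat.
  have j0 := ler0n R j.+1.
  have := truncated_mgf_le W Ws delta zbW iW delta_ge0 near_coupling X _ X_ge0 j0.
  rewrite /truncated_mgf => /(ler_wpM2l (c0 j))/le_trans; apply.
  rewrite /c -[leLHS]mulrA -expRD ler_pM ?expR_ge0 ?addr_ge0 ?sqr_ge0//.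
    by rewrite lerD2l !expr2 ler_pM.
  rewrite ler_expR.
  have := mgf_exponent_le _ _ _ X_ge0 j0 (le_trans jn nX) delta_ge0 delta_le1 X_moderate.
  by rewrite /K; lra.
apply: (@le_trans _ _ (\int[P]_t (1 + \sum_(j < n) f j t))).
  apply: le_Rintegral => //; first exact: integrable_weight.
    exact: integrable_add.
  by move=> t _; exact: weight_le_sum_exp.
rewrite RintegralD// ES.
have E1 : \int[P]_t (1 : R) <= 1.
  by rewrite Rintegral_probability_cst.
have S1 : \sum_(j < n) \int[P]_t f j t <= n%:R * (1 + n%:R ^+ 2) * expR (K + 1).
  apply: (le_trans (ler_sum _ (fun j _ => term j))).
  by rewrite sumr_const card_ord -[leLHS]mulr_natl mulrA.
have KE : K + 1 = 3 + 18 * expR 37 by rewrite /K; ring.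
apply: (le_trans (lerD E1 S1)); rewrite KE {term S1}.
have := expR_ge0 (3 + 18 * expR 37 : R).
move: (expR (3 + 18 * expR 37)) => e e0.
have n0 := ler0n R n.
have N1 : n%:R * (1 + n%:R ^+ 2) <= (X + 1) * (1 + (X + 1) ^+ 2).
  by rewrite ler_pM ?addr_ge0 ?sqr_ge0// lerD2l !expr2 ler_pM.
have N2 : (X + 1) * (1 + (X + 1) ^+ 2) <= 10 * (1 + X ^+ 3).
  have := sqr_ge0 (X - 1); have := mulr_ge0 X_ge0 (sqr_ge0 (X - 1)); nra.
have := ler_wpM2r e0 (le_trans N1 N2).
have : 0 <= X ^+ 3 by rewrite exprn_ge0.
nra.
Qed.

End ExpectedWeight.

(** * The Stein solution for a half-line *)

Section SteinSolution.
Context {R : realType}.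
Implicit Types (w y : R).

(** The pieces of the solution of Stein's equation for the half-line [y, +oo[, and
their derivatives. *)
Definition stein_left y w : R := gtail y * mills (- w).
Definition stein_right y w : R := (1 - gtail y) * mills w.
Definition stein_left' y w : R := gtail y * (1 + w * mills (- w)).
Definition stein_right' y w : R := (1 - gtail y) * (w * mills w - 1).

Definition stein y : R -> R := glue y (stein_left y) (stein_right y).
Definition stein' y : R -> R := glue y (stein_left' y) (stein_right' y).

Lemma is_derive_stein_left y w :
  is_derive w 1 (stein_left y) (stein_left' y w).
Proof.
have dm := is_derive1_reflect _ _ _ (is_derive_mills (- w)).
apply: is_derive_eq (is_derive1M _ _ _ _ _ (is_derive_cst (gtail y) w 1) dm) _.
by rewrite /stein_left' /=; ring.
Qed.

Lemma is_derive_stein_right y w :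
  is_derive w 1 (stein_right y) (stein_right' y w).
Proof.
apply: is_derive_eq (is_derive1M _ _ _ _ _ (is_derive_cst (1 - gtail y) w 1)
  (is_derive_mills w)) _.
by rewrite /stein_right' /=; ring.
Qed.

Lemma stein_continuous y : stein_left y y = stein_right y y.
Proof.
rewrite /stein_left /stein_right /mills gdensityN gtailN; ring.
Qed.

Lemma measurable_mills : measurable_fun setT (@mills R).
Proof. exact: is_derive1_measurable (@is_derive_mills R). Qed.

Lemma measurable_stein_left' y : measurable_fun setT (stein_left' y).
Proof.
apply: measurable_funM => //; apply: measurable_funD => //.
apply: measurable_funM => //; apply: is_derive1_measurable => w.
exact/is_derive1_reflect/is_derive_mills.
Qed.

Lemma measurable_stein_right' y : measurable_fun setT (stein_right' y).
Proof.
apply: measurable_funM => //; apply: measurable_funB => //.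
by apply: measurable_funM => //; exact: measurable_mills.
Qed.

Lemma measurable_stein y : measurable_fun setT (stein y).
Proof.
by apply: measurable_glue; [apply: is_derive1_measurable (is_derive_stein_left y)
  |apply: is_derive1_measurable (is_derive_stein_right y)].
Qed.

Lemma stein_equation y w :
  stein' y w = w * stein y w + (gtail y - (y <= w)%R%:R).
Proof.
rewrite /stein' /stein /glue /stein_left /stein_right /stein_left' /stein_right'.
by have [wy|yw] := ltP w y; rewrite /=; ring.
Qed.

Definition stein_sup y : R := mills (- y) + mills y.

Definition stein'_sup y : R := 1 + `|y| * stein_sup y.

Lemma stein_left_le y w : w <= y -> `|stein_left y w| <= stein_sup y.
Proof.
move=> wy; rewrite /stein_left normrM (ger0_norm (gtail_ge0 y)).
rewrite (ger0_norm (mills_ge0 _)) -[leRHS]mul1r.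
apply: ler_pM; [exact: gtail_ge0|exact: mills_ge0|exact: gtail_le1|].
have := mills_nincr (- y) (- w); rewrite lerN2 => /(_ wy)/le_trans; apply.
by rewrite /stein_sup lerDl mills_ge0.
Qed.

Lemma stein_right_le y w : y <= w -> `|stein_right y w| <= stein_sup y.
Proof.
move=> yw; have g1 : 0 <= 1 - gtail y by rewrite subr_ge0 gtail_le1.
rewrite /stein_right normrM (ger0_norm g1) (ger0_norm (mills_ge0 _)).
rewrite -[leRHS]mul1r; apply: ler_pM => //; first exact: mills_ge0.
  by rewrite lerBlDr lerDl gtail_ge0.
by rewrite (le_trans (mills_nincr _ _ yw))// /stein_sup lerDr mills_ge0.
Qed.

(** Either v >= 0 and v M(v) lies in [0, 1], or u <= v < 0 and monotonicity of M
applies. *)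
Lemma mills_slope_le (u v c : R) : `|c| <= 1 -> u <= v ->
  `|c * (v * mills v - 1)| <= 1 + `|u| * mills u.
Proof.
move=> c1 uv; rewrite normrM -[leRHS]mul1r ler_pM//.
have um : 0 <= `|u| * mills u by rewrite mulr_ge0 ?mills_ge0.
have [v0|/ltW v0] := leP 0 v.
  have := mills_upper _ v0; have := mulr_ge0 v0 (mills_ge0 v).
  by rewrite ler_norml; lra.
rewrite ler0_norm; last first.
  by rewrite subr_le0 (le_trans (mulr_le0_ge0 v0 (mills_ge0 v))).
rewrite opprB lerD2l -mulNr ler_pM ?mills_ge0 ?oppr_ge0//.
  by rewrite ler0_norm ?lerN2// (le_trans uv).
exact: mills_nincr.
Qed.

Lemma stein_left'_le y w : w <= y -> `|stein_left' y w| <= stein'_sup y.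
Proof.
move=> wy.
have -> : stein_left' y w = - gtail y * (- w * mills (- w) - 1).
  by rewrite /stein_left'; ring.
apply: (le_trans (mills_slope_le (- y) (- w) _ _ _)).
- by rewrite normrN ger0_norm ?gtail_ge0 ?gtail_le1.
- by rewrite lerN2.
- by rewrite normrN lerD2l ler_wpM2l// lerDl mills_ge0.
Qed.

Lemma stein_right'_le y w : y <= w -> `|stein_right' y w| <= stein'_sup y.
Proof.
move=> yw; apply: (le_trans (mills_slope_le y w _ _ yw)).
- rewrite ger0_norm ?subr_ge0 ?gtail_le1//.
  by rewrite lerBlDr lerDl gtail_ge0.
- by rewrite lerD2l ler_wpM2l// lerDr mills_ge0.
Qed.

(** The derivatives of w f(w), where f is the Stein solution: these measure how
E[W f(W)] changes when W is replaced by Ws. *)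
Definition xstein_left' y w : R := gtail y * ((1 + w ^+ 2) * mills (- w) + w).
Definition xstein_right' y w : R := (1 - gtail y) * ((1 + w ^+ 2) * mills w - w).

Lemma is_derive_xstein_left y w :
  is_derive w 1 (fun v => v * stein_left y v) (xstein_left' y w).
Proof.
apply: is_derive_eq (is_derive1M _ _ _ _ _ (@is_derive_id R R w 1)
  (is_derive_stein_left y w)) _.
by rewrite /xstein_left' /stein_left /stein_left' /=; ring.
Qed.

Lemma is_derive_xstein_right y w :
  is_derive w 1 (fun v => v * stein_right y v) (xstein_right' y w).
Proof.
apply: is_derive_eq (is_derive1M _ _ _ _ _ (@is_derive_id R R w 1)
  (is_derive_stein_right y w)) _.
by rewrite /xstein_right' /stein_right /stein_right' /=; ring.
Qed.

Lemma xsteinE y w : w * stein y w =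
  glue y (fun v => v * stein_left y v) (fun v => v * stein_right y v) w.
Proof. by rewrite /stein /glue; case: ifP. Qed.

(** A constant dominating each of the four quantities of [stein_const_ge] that the
case analysis of the next two bounds produces. *)
Definition stein_const : R :=
  (2 * (2 * mills (-1) + 1) + 1) * ((normal_peak 1)^-1 + 1).

Lemma stein_const_ge : let K0 : R := 2 * mills (-1) + 1 in
  let c : R := (normal_peak 1)^-1 in
  [/\ K0 <= stein_const, c + 1 <= stein_const, 2 * K0 <= stein_const &
    2 * K0 * c <= stein_const].
Proof.
have m0 := mills_ge0 (-1 : R).
have c0 : 0 <= (normal_peak (1 : R))^-1 by rewrite invr_ge0 ltW ?normal_peak1_gt0.
rewrite /= /stein_const; move: (mills (-1)) m0 => m m0.
move: (normal_peak 1)^-1 c0 => c c0; split; nra.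
Qed.

Lemma stein_const_ge0 : 0 <= stein_const.
Proof.
have [H _ _ _] := stein_const_ge; apply: le_trans H.
by rewrite addr_ge0// mulr_ge0 ?mills_ge0.
Qed.

(** For w <= 0 the bracket is the Mills defect at - w, which is bounded.  For
0 <= w <= y it is of order (1 + w^2) exp(w^2 / 2), as M(- w) <= 1 / phi(w). *)
Lemma xstein_left'_le y w : -1 <= y -> w <= y ->
  `|xstein_left' y w| <= stein_const * gtail y * weight (clamp (Num.max 0 y) w).
Proof.
move=> y1 wy; have [K1 K2 _ _] := stein_const_ge; have K0 := stein_const_ge0.
rewrite normrM ger0_norm ?gtail_ge0// mulrAC [leRHS]mulrC ler_wpM2l ?gtail_ge0//.
have [w0|/ltW w0] := leP w 0.
  have : -1 <= - w by rewrite lerN2 (le_trans w0).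
  move=> /mills_defect_le; rewrite sqrrN opprK => /le_trans; apply.
  by rewrite (le_trans K1)// ler_peMr// weight_ge1.
have y0 := le_trans w0 wy.
have -> : clamp (Num.max 0 y) w = w.
  by rewrite /clamp (max_r y0) (min_l wy) max_r.
have mN := mills_ge0 (- w).
have w2 : 0 <= 1 + w ^+ 2 by rewrite addr_ge0 ?sqr_ge0.
rewrite ger0_norm; last by rewrite addr_ge0// (mulr_ge0 w2 mN).
apply: (@le_trans _ _ (((normal_peak 1)^-1 + 1) * weight w)); last first.
  by rewrite ler_wpM2r// (le_trans _ (weight_ge1 w)).
rewrite [leRHS]mulrDl mul1r; apply: lerD.
  by rewrite /weight [leRHS]mulrCA; apply: ler_wpM2l => //; exact: millsN_le.
rewrite /weight -[leLHS]mulr1; apply: ler_pM => //.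
  by have := sqr_ge0 (w - 1); nra.
by rewrite -expR0 ler_expR divr_ge0// sqr_ge0.
Qed.

(** The bracket is the Mills defect, hence bounded, so it remains to see that
T(y) times the weight at max(0, y) is bounded below; for y >= 0 this product is
a multiple of (1 + y^2) M(y). *)
Lemma xstein_right'_le y w : -1 <= y -> y <= w ->
  `|xstein_right' y w| <= stein_const * gtail y * weight (clamp (Num.max 0 y) w).
Proof.
move=> y1 yw; have [_ _ K3 K4] := stein_const_ge; have K0 := stein_const_ge0.
have w1 := le_trans y1 yw; have g0 := gtail_ge0 y.
have m1 := mills_ge0 (-1 : R).
apply: (@le_trans _ _ (2 * mills (-1) + 1)).
  rewrite normrM -[leRHS]mul1r ler_pM ?mills_defect_le//.
  rewrite ger0_norm ?subr_ge0 ?gtail_le1//.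
  by rewrite lerBlDr lerDl gtail_ge0.
case/orP: (le_total y 0) => y0.
  have g2 := gtail_ge_half _ y0.
  have := weight_ge1 (clamp (Num.max 0 y) w).
  move: (weight _) => b b1.
  have : stein_const * 2^-1 <= stein_const * gtail y by rewrite ler_wpM2l.
  move=> Hg; apply: (@le_trans _ _ (stein_const * gtail y)); first lra.
  by have := ler_wpM2l (mulr_ge0 K0 g0) b1; rewrite mulr1.
have -> : clamp (Num.max 0 y) w = y.
  by rewrite /clamp (max_r y0) (min_r yw) max_r.
have gE : gtail y = mills y * (normal_peak 1 / expR (y ^+ 2 / 2)).
  by rewrite -expRN -gdensityE /mills divfK ?gdensity_neq0.
have H := mills_sqr_ge y y0; rewrite gE /weight.
have e0 : expR (y ^+ 2 / 2) != 0 by rewrite gt_eqF ?expR_gt0.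
have p0 := normal_peak1_gt0 (R := R).
move: (mills y) (expR _) (normal_peak 1) K4 e0 p0 H => m e p K4 e0 p0 H.
have -> : stein_const * (m * (p / e)) * ((1 + y ^+ 2) * e) =
  stein_const * p * ((1 + y ^+ 2) * m) by field.
apply: (@le_trans _ _ (stein_const * p * 2^-1)); last first.
  by apply: ler_wpM2l => //; rewrite mulr_ge0// ltW.
have := ler_wpM2r (ltW p0) K4; rewrite -[_ * p^-1 * p]mulrA mulVf ?gt_eqF//.
by lra.
Qed.

(** w f(w) is Lipschitz below max(u, v) with a constant governed by the weight,
which is nondecreasing. *)
Lemma xstein_increment y u v : -1 <= y ->
  `|v * stein y v - u * stein y u| <=
  stein_const * gtail y * weight (clamp (Num.max 0 y) (Num.max u v)) * `|v - u|.
Proof.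
move=> y1; wlog uv : u v / u <= v.
  move=> H; case/orP: (le_total u v) => [|vu]; first exact: H.
  by rewrite distrC [`|v - u|]distrC [Num.max u v]maxC; exact: H.
have vu0 : 0 <= v - u by rewrite subr_ge0.
rewrite (max_r uv) (ger0_norm vu0) !xsteinE.
have K0 := stein_const_ge0.
have L w : w <= v -> stein_const * gtail y * weight (clamp (Num.max 0 y) w) <=
    stein_const * gtail y * weight (clamp (Num.max 0 y) v).
  move=> wv; apply: ler_wpM2l; first exact: mulr_ge0 K0 (gtail_ge0 y).
  by apply: weight_homo; [exact: clamp_ge0|exact: clamp_homo].
have Lv0 w : w <= v -> w <= y -> `|xstein_left' y w| <=
    stein_const * gtail y * weight (clamp (Num.max 0 y) v).
  by move=> wv wy; apply: le_trans (L _ wv); exact: xstein_left'_le.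
have Lv1 w : w <= v -> y <= w -> `|xstein_right' y w| <=
    stein_const * gtail y * weight (clamp (Num.max 0 y) v).
  by move=> wv yw; apply: le_trans (L _ wv); exact: xstein_right'_le.
have F12 : y * stein_left y y = y * stein_right y y by rewrite stein_continuous.
exact: (@glue_increment R y _ _ _ _ u v _ (is_derive_xstein_left y)
  (is_derive_xstein_right y) F12 uv (fun w uwv => Lv0 w (proj2 (andP uwv)))
  (fun w uwv => Lv1 w (proj2 (andP uwv)))).
Qed.

End SteinSolution.

(** * The tail of the zero-biased variable *)

Section ZeroBiasTail.
Context {R : realType} {d} {T : measurableType d} {P : probability T R}.
Variables (W Ws : {RV P >-> R}) (delta y : R).

Hypothesis zbW : zero_bias_identity W Ws.
Hypothesis iW : P.-integrable setT (EFin \o (W : T -> R)).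
Hypothesis delta_ge0 : 0 <= delta.
Hypothesis delta_le1 : delta <= 1.
Hypothesis near_coupling : {ae P, forall t, `|W t - Ws t| <= delta}.
Hypothesis y_ge : -1 <= y.

Local Notation X := (Num.max 0 y).

Hypothesis y_moderate : X ^+ 3 * delta <= 8.

(** Stein's equation bounds w f(w) by f'(w) and a bounded term. *)
Lemma integrable_xstein (Y : {RV P >-> R}) :
  P.-integrable setT (EFin \o (fun t => Y t * stein y (Y t))).
Proof.
apply: (bounded_integrable _ (stein'_sup y + 1)).
  apply: measurable_funM => //.
  exact: (measurableT_comp (measurable_stein y)).
move=> t; have -> : Y t * stein y (Y t) =
    stein' y (Y t) - (gtail y - (y <= Y t)%R%:R).
  by rewrite stein_equation addrK.
rewrite (le_trans (ler_normB _ _))// lerD//.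
  rewrite /stein' /glue; case: (ltP (Y t) y) => yY.
    by rewrite stein_left'_le// ltW.
  by rewrite stein_right'_le.
have := gtail_ge0 y; have := gtail_le1 y.
by case: (y <= Y t); rewrite ler_norml /=; lra.
Qed.

Lemma zero_bias_stein : \int[P]_t (W t * stein y (W t)) =
  \int[P]_t (Ws t * stein y (Ws t)) + (gtail y - fine (P [set t | y <= Ws t])).
Proof.
have E := @zero_bias_glue R d T P W Ws zbW y (stein_sup y) (stein'_sup y)
  _ _ _ _ (is_derive_stein_left y) (is_derive_stein_right y)
  (stein_continuous y) (measurable_stein_left' y) (measurable_stein_right' y)
  (stein_left_le y) (stein_right_le y) (stein_left'_le y) (stein_right'_le y).
rewrite (_ : \int[P]_t (W t * stein y (W t)) = \int[P]_t stein' y (Ws t))//.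
have mA := measurable_ge_event Ws y.
rewrite -(Rintegral_event _ mA).
have iA : P.-integrable setT (EFin \o \1_[set t | y <= Ws t]).
  exact: integrable_indic.
have ig := @integrable_cst R d T P (gtail y).
rewrite -[X in _ + (X - _)](Rintegral_probability_cst (P := P)) -RintegralB// -RintegralD//.
- by apply: eq_Rintegral => t _; rewrite stein_equation indicE/= mem_setE.
- exact: integrable_xstein.
- exact: integrable_sub.
Qed.

(** The product of the constants in the derivative bound, in [weight_shift] and in
[expected_weight_le]. *)
Definition tail_const : R :=
  stein_const * (3 * expR 10) * (1 + 10 * expR (3 + 18 * expR 37)).

Lemma tail_const_ge0 : 0 <= tail_const.
Proof.
have e0 (a : R) := expR_ge0 a.
apply: mulr_ge0; last by rewrite addr_ge0// mulr_ge0.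
by apply: mulr_ge0; [exact: stein_const_ge0|rewrite mulr_ge0].
Qed.

Lemma zero_bias_tail : `|fine (P [set t | y <= Ws t]) - gtail y| <=
  tail_const * (1 + X ^+ 3) * delta * gtail y.
Proof.
have X0 : 0 <= X by rewrite le_max lexx.
have -> : fine (P [set t | y <= Ws t]) - gtail y =
    \int[P]_t (Ws t * stein y (Ws t)) - \int[P]_t (W t * stein y (W t)).
  by rewrite zero_bias_stein; ring.
have iS := integrable_xstein Ws; have iZ := integrable_xstein W.
rewrite -RintegralB//.
have iD := integrable_sub _ _ iS iZ.
apply: (le_trans (le_normr_Rintegral measurableT iD)).
pose c : R := stein_const * gtail y * (3 * expR 10) * delta.
have c0 : 0 <= c.
  have e0 : 0 <= 3 * expR 10 :> R by rewrite mulr_ge0// expR_ge0.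
  have sg := mulr_ge0 (stein_const_ge0 (R := R)) (gtail_ge0 y).
  exact: mulr_ge0 (mulr_ge0 sg e0) delta_ge0.
have iw := integrable_weight X W X0.
have iN : P.-integrable setT (EFin \o
    (fun t => `|Ws t * stein y (Ws t) - W t * stein y (W t)|)).
  exact: (integrable_norm iD).
apply: (@le_trans _ _ (\int[P]_t (c * weight (clamp X (W t))))).
  apply: ae_le_Rintegral => //; first exact: integrable_scale.
  apply: filterS near_coupling => t Wt.
  apply: (le_trans (xstein_increment _ _ _ y_ge)).
  have WsW : Num.max (W t) (Ws t) <= W t + delta.
    rewrite ge_max lerDl delta_ge0 /=.
    by move: Wt; rewrite ler_distlC => /andP[].
  have ww : weight (clamp X (Num.max (W t) (Ws t))) <=
      3 * expR 10 * weight (clamp X (W t)).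
    apply: le_trans (weight_shift X (W t) delta X0 delta_ge0 delta_le1 y_moderate).
    by apply: weight_homo; [exact: clamp_ge0|exact: clamp_homo].
  have sg := mulr_ge0 (stein_const_ge0 (R := R)) (gtail_ge0 y).
  have wp : 0 <= weight (clamp X (Num.max (W t) (Ws t))).
    by rewrite (le_trans _ (weight_ge1 _)).
  rewrite distrC in Wt.
  have -> : c * weight (clamp X (W t)) = stein_const * gtail y *
    (3 * expR 10 * weight (clamp X (W t))) * delta by rewrite /c; ring.
  apply: ler_pM => //; first exact: mulr_ge0 sg wp.
  exact: ler_wpM2l sg _ _ ww.
rewrite RintegralZl//.
have H := expected_weight_le W Ws delta X zbW iW delta_ge0 delta_le1 near_coupling
  X0 y_moderate.
apply: (le_trans (ler_wpM2l c0 H)); rewrite /c /tail_const le_eqVlt; apply/orP; left.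
by apply/eqP; ring.
Qed.

End ZeroBiasTail.

(** * Shifting the argument of the normal tail *)

Section GaussianShift.
Context {R : realType}.
Implicit Types (x delta : R).

Lemma gdensity_le_gtail x : 0 <= x -> gdensity x <= 2 * (1 + x) * gtail x.
Proof.
move=> x0; have := mills_inv_le x x0.
by rewrite /mills mulrA ler_pdivlMr ?gdensity_gt0// mul1r.
Qed.

(** From w^2 >= 2 x w - x^2. *)
Lemma gdensity_shift x w delta : 0 <= x -> x - delta <= w -> w <= x ->
  gdensity w <= gdensity x * expR (x * delta).
Proof.
move=> x0 xw wx; rewrite !gdensityE -[leRHS]mulrA -expRD.
apply: ler_wpM2l; first exact: ltW normal_peak1_gt0.
rewrite ler_expR.
have := sqr_ge0 (x - w); have := ler_wpM2l x0 xw; nra.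
Qed.

Lemma gtail_increment u v (L : R) : u <= v ->
  (forall w, u <= w <= v -> gdensity w <= L) ->
  gtail u - gtail v <= L * (v - u).
Proof.
move=> uv gL; rewrite (le_trans (ler_norm _))// distrC.
apply: (is_derive_increment _ _ _ _ _ uv (fun w _ => is_derive_gtail w)) => w uwv.
by rewrite normrN ger0_norm ?gL// ltW ?gdensity_gt0.
Qed.

Lemma gtail_left_shift x delta : 0 <= x -> 0 <= delta -> x * delta <= 2 ->
  gtail (x - delta) <= gtail x * (1 + 2 * expR 2 * (1 + x) * delta).
Proof.
move=> x0 d0 xd.
have uv : x - delta <= x by rewrite lerBlDr lerDl.
have e2 : expR (x * delta) <= expR 2 by rewrite ler_expR.
have g0 := gtail_ge0 x.
have H : gtail (x - delta) - gtail x <=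
    2 * (1 + x) * gtail x * expR 2 * (x - (x - delta)).
  apply: gtail_increment => // w /andP[xw wx].
  apply: (le_trans (gdensity_shift _ _ _ x0 xw wx)).
  by apply: ler_pM; [exact: ltW (gdensity_gt0 x)|exact: expR_ge0|
    exact: gdensity_le_gtail|].
rewrite (_ : x - (x - delta) = delta) in H; last by ring.
lra.
Qed.

Lemma gtail_right_shift x delta : 0 <= x -> 0 <= delta ->
  gtail x * (1 - 2 * (1 + x) * delta) <= gtail (x + delta).
Proof.
move=> x0 d0.
have H : gtail x - gtail (x + delta) <= 2 * (1 + x) * gtail x * (x + delta - x).
  apply: gtail_increment => [|w /andP[xw _]]; first by rewrite lerDl.
  apply: le_trans (gdensity_le_gtail _ x0); rewrite !gdensityE.
  apply: ler_wpM2l; first exact: ltW normal_peak1_gt0.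
  by rewrite ler_expR lerN2 ler_wpM2r// !expr2 ler_pM.
rewrite (_ : x + delta - x = delta) in H; last by ring.
lra.
Qed.

End GaussianShift.

(** * From the zero-biased variable to the original one *)

Section ModerateDeviation.
Context {R : realType} {d} {T : measurableType d} {P : probability T R}.
Variables (W Ws : {RV P >-> R}) (delta : R).

Hypothesis near_coupling : {ae P, forall t, `|W t - Ws t| <= delta}.

(** A negative delta would make the coupling event empty, yet it has probability
one. *)
Lemma coupling_bound_ge0 : 0 <= delta.
Proof.
rewrite leNgt; apply/negP => d0.
have := @ae_le_Rintegral R d T P (fun=> 1) (fun=> 0)
  (integrable_cst 1) (integrable_cst 0).
rewrite !Rintegral_probability_cst ler10 => /(_ _)/negP; apply => //.
apply: filterS near_coupling => t /(le_lt_trans)/(_ d0).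
by rewrite normr_lt0.
Qed.

Lemma coupling_tail_le (X Y : {RV P >-> R}) (x : R) :
  {ae P, forall t, X t <= Y t + delta} ->
  fine (P [set t | x <= X t]) <= fine (P [set t | x - delta <= Y t]).
Proof.
move=> XY; have mX := measurable_ge_event X x.
have mY := measurable_ge_event Y (x - delta).
rewrite -!Rintegral_event//.
apply: ae_le_Rintegral; [exact: integrable_indic..|].
apply: filterS XY => t tXY; rewrite !indicE.
have [/set_mem/= xX|_] := boolP (t \in [set t | x <= X t]); last exact: ler0n.
by rewrite mem_set//= lerBlDr (le_trans xX).
Qed.

Hypothesis zbW : zero_bias_identity W Ws.
Hypothesis iW : P.-integrable setT (EFin \o (W : T -> R)).
Hypothesis delta_le1 : delta <= 1.

Lemma upper_tail_le (x : R) : 0 <= x -> x ^+ 3 * delta <= 1 ->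
  fine (P [set t | x <= W t]) <= gtail x *
    (1 + 2 * expR 2 * (1 + x) * delta) * (1 + tail_const * (1 + x ^+ 3) * delta).
Proof.
move=> x0 xd; have d0 := coupling_bound_ge0; have d1 := delta_le1.
have C0 := tail_const_ge0 (R := R).
have WWs : {ae P, forall t, W t <= Ws t + delta}.
  by apply: filterS near_coupling => t; rewrite distrC ler_distlC => /andP[].
apply: (le_trans (coupling_tail_le _ _ _ WWs)).
pose X := Num.max 0 (x - delta).
have X0 : 0 <= X by rewrite le_max lexx.
have Xx : X <= x by rewrite ge_max x0 lerBlDr lerDl.
have X3 : X ^+ 3 <= x ^+ 3 by rewrite lerXn2r ?nnegrE.
have y1 : -1 <= x - delta by lra.
have Xd : X ^+ 3 * delta <= 8.
  by have := ler_wpM2r d0 X3; lra.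
have := zero_bias_tail W Ws delta (x - delta) zbW iW d0 delta_le1 near_coupling y1 Xd.
rewrite -/X ler_norml => /andP[_]; rewrite lerBlDr => /le_trans; apply.
have xd2 : x * delta <= 2.
  have x1 : x <= 1 + x ^+ 3.
    have := sqr_ge0 (x - 1); have := mulr_ge0 x0 (sqr_ge0 (x - 1)); nra.
  by have := ler_wpM2r d0 x1; lra.
have gl := gtail_left_shift _ _ x0 d0 xd2.
have g0 := gtail_ge0 (x - delta).
have cX : tail_const * (1 + X ^+ 3) * delta <= tail_const * (1 + x ^+ 3) * delta.
  by apply: ler_wpM2r => //; apply: ler_wpM2l => //; rewrite lerD2l.
have cX0 : 0 <= tail_const * (1 + X ^+ 3) * delta.
  by apply: mulr_ge0 => //; apply: mulr_ge0 => //; rewrite addr_ge0// exprn_ge0.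
rewrite -[X in _ + X <= _]mul1r -mulrDl mulrC; apply: ler_pM => //.
  by rewrite addr_ge0.
by rewrite addrC lerD2l.
Qed.

(** The error of the shift and the error of the zero bias tail are both measured
against T(x) >= T(x + delta), so they simply add up. *)
Lemma upper_tail_ge (x : R) : 0 <= x -> x ^+ 3 * delta <= 1 ->
  gtail x * (1 - 2 * (1 + x) * delta - 5 * tail_const * (1 + x ^+ 3) * delta) <=
  fine (P [set t | x <= W t]).
Proof.
move=> x0 xd; have d0 := coupling_bound_ge0; have d1 := delta_le1.
have C0 := tail_const_ge0 (R := R).
have WsW : {ae P, forall t, Ws t <= W t + delta}.
  by apply: filterS near_coupling => t; rewrite ler_distlC => /andP[].
have := coupling_tail_le _ _ (x + delta) WsW; rewrite addrK => /(le_trans _); apply.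
have y0 : 0 <= x + delta by rewrite addr_ge0.
have y1 : -1 <= x + delta by lra.
have y3 : (x + delta) ^+ 3 <= 4 * (x ^+ 3 + delta ^+ 3).
  rewrite -subr_ge0.
  have -> : 4 * (x ^+ 3 + delta ^+ 3) - (x + delta) ^+ 3 =
    3 * ((x - delta) ^+ 2 * (x + delta)) by ring.
  by rewrite mulr_ge0// mulr_ge0 ?sqr_ge0.
have d3 : delta ^+ 3 <= 1 by rewrite exprn_ile1.
have yd : (Num.max 0 (x + delta)) ^+ 3 * delta <= 8.
  rewrite max_r//; have := ler_wpM2r d0 y3; have := ler_wpM2r d0 d3; lra.
have := zero_bias_tail W Ws delta (x + delta) zbW iW d0 delta_le1 near_coupling y1 yd.
rewrite max_r// ler_norml => /andP[+ _]; rewrite lerBrDl => /(le_trans _); apply.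
have gr := gtail_right_shift _ _ x0 d0.
have gx : gtail (x + delta) <= gtail x by apply: gtail_nincr; rewrite lerDl.
have g0 := gtail_ge0 (x + delta).
have c1 : tail_const * (1 + (x + delta) ^+ 3) * delta <=
    5 * tail_const * (1 + x ^+ 3) * delta.
  apply: ler_wpM2r => //; rewrite -[leRHS]mulrA [leRHS]mulrCA.
  apply: ler_wpM2l => //.
  have := exprn_ge0 3 x0; lra.
have c0 : 0 <= tail_const * (1 + (x + delta) ^+ 3) * delta.
  by apply: mulr_ge0 => //; apply: mulr_ge0 => //; rewrite addr_ge0// exprn_ge0.
have := ler_pM c0 g0 c1 gx; lra.
Qed.

End ModerateDeviation.

Lemma integrable_of_variance {R : realType} {d} {T : measurableType d}
    {P : probability T R} (W : {RV P >-> R}) :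
  ('E_P[fun t => (W t ^+ 2)%R] = 1)%E -> P.-integrable setT (EFin \o (W : T -> R)).
Proof.
move=> W2; have mW2 : measurable_fun setT (fun t => W t ^+ 2) by exact: measurable_funX.
have i2 : P.-integrable setT (EFin \o (fun t => W t ^+ 2)).
  apply/integrableP; split; first exact/measurable_EFinP.
  under eq_integral do rewrite /= ger0_norm ?sqr_ge0//.
  by move: W2; rewrite unlock => ->; rewrite ltry.
apply: (integrable_dominated _ (fun t => 1 + W t ^+ 2)) => //.
  move=> t; rewrite [leRHS]ger0_norm ?addr_ge0 ?sqr_ge0// -(real_normK (num_real (W t))).
  by have := sqr_ge0 (`|W t| - 1); nra.
by apply: integrable_add => //; exact: integrable_cst.
Qed.

Lemma cube_mul_le1 {R : realType} (x delta : R) : 0 <= x -> 0 <= delta ->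
  (0 < delta -> x <= delta `^ (- 3^-1)) -> x ^+ 3 * delta <= 1.
Proof.
move=> x0; rewrite le_eqVlt => /predU1P[<- _|d0 /(_ d0) xd]; first by rewrite mulr0.
have : x ^+ 3 <= (delta `^ (- 3^-1)) ^+ 3 by rewrite lerXn2r ?nnegrE ?powR_ge0.
have -> : (delta `^ (- 3^-1)) ^+ 3 = delta^-1.
  by rewrite -powR_mulrn ?powR_ge0// -powRrM mulNr mulVf// powRN powRr1 ?ltW.
by move=> /(ler_wpM2r (ltW d0)); rewrite mulVf ?gt_eqF.
Qed.

Theorem corollary3p1 (R : realType) :
  exists C : R,
    forall (d : measure_display) (T : measurableType d) (P : probability T R)
      (W Ws : {RV P >-> R}) (delta : R),
    zero_bias_identity W Ws ->
    ('E_P[W] = 0)%E ->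
    ('E_P[fun t => (W t ^+ 2)%R] = 1)%E ->
    {ae P, forall t, `|W t - Ws t| <= delta} ->
    forall x : R, 0 <= x ->
    (* delta^(-1/3) = +oo when delta = 0 *)
    (0 < delta -> x <= delta `^ (- 3^-1)) ->
    `|fine (P [set t | x <= W t]) / (1 - Phi x) - 1| <= C * (1 + x ^+ 3) * delta.
Proof.
pose K : R := tail_const; pose E : R := 2 * expR 2.
have K0 : 0 <= K := tail_const_ge0.
have E0 : 0 <= E by rewrite mulr_ge0// expR_ge0.
have iG0 : 0 <= (gtail (1 : R))^-1 by rewrite invr_ge0 gtail_ge0.
exists (2 * E + K + 4 * E * K + 5 * K + 4 + ((gtail 1)^-1 + 1)).
move=> d T P W Ws delta zbW _ W2 near x x0 xd.
have iW := integrable_of_variance W W2.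
have d0 := coupling_bound_ge0 W Ws delta near.
have xd1 := cube_mul_le1 _ _ x0 d0 xd.
have x30 : 0 <= x ^+ 3 by rewrite exprn_ge0.
rewrite -/(gtail x); have g0 := gtail_gt0 x.
have [d1|d1] := leP delta 1; last first.
  have x1 : x <= 1.
    rewrite leNgt; apply/negP => x_gt1.
    have x31 : 1 < x ^+ 3 by rewrite exprn_egt1.
    by nra.
  have p1 : 0 <= fine (P [set t | x <= W t]) <= 1.
    rewrite fine_ge0//= -lee_fin fineK ?probability_le1//.
      exact: measurable_ge_event.
    by rewrite fin_num_measure//; exact: measurable_ge_event.
  have q0 : 0 <= fine (P [set t | x <= W t]) / gtail x.
    by case/andP: p1 => p0 _; rewrite divr_ge0// ltW.
  have q1 : fine (P [set t | x <= W t]) / gtail x <= (gtail 1)^-1.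
    case/andP: p1 => p0 p1; rewrite -[leRHS]mul1r; apply: ler_pM => //.
      by rewrite invr_ge0 ltW.
    by rewrite lef_pV2 ?posrE ?gtail_gt0// gtail_nincr.
  apply: (@le_trans _ _ ((gtail 1)^-1 + 1)).
    by rewrite ler_norml; lra.
  rewrite -mulrA -[leLHS]mulr1; apply: ler_pM => //; first by rewrite addr_ge0.
    by have := mulr_ge0 E0 K0; lra.
  by nra.
set z := (1 + x ^+ 3) * delta.
have z0 : 0 <= z by rewrite mulr_ge0// addr_ge0.
have z2 : z <= 2 by rewrite /z; lra.
have xz : (1 + x) * delta <= 2 * z.
  rewrite /z mulrA; apply: ler_wpM2r => //.
  have := sqr_ge0 (x - 1); have := mulr_ge0 x0 (sqr_ge0 (x - 1)); nra.
have up := upper_tail_le W Ws delta near zbW iW d1 _ x0 xd1.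
have lo := upper_tail_ge W Ws delta near zbW iW d1 _ x0 xd1.
rewrite -mulrA -/z ler_norml; apply/andP; split.
  rewrite lerBrDr ler_pdivlMr// mulrC; apply: le_trans lo.
  apply: ler_wpM2l; first exact: ltW.
  rewrite -[5 * tail_const * _ * _]mulrA -/z -/K -[2 * _ * _]mulrA.
  have Kz := mulr_ge0 K0 z0; have Ez := mulr_ge0 E0 z0.
  have EKz := mulr_ge0 E0 Kz; have Gz := mulr_ge0 iG0 z0.
  by nra.
rewrite lerBlDr ler_pdivrMr// [leRHS]mulrC; apply: (le_trans up).
rewrite -[leLHS]mulrA; apply: ler_wpM2l; first exact: ltW.
rewrite -/E -/K -[E * _ * _]mulrA -[K * _ * _]mulrA -/z.
have xE := ler_wpM2l E0 xz.
have xz0 : 0 <= (1 + x) * delta by rewrite mulr_ge0// addr_ge0.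
have Kz := mulr_ge0 K0 z0; have Ez := mulr_ge0 E0 z0.
have EKz := mulr_ge0 E0 Kz; have Gz := mulr_ge0 iG0 z0.
have H1 : (1 + E * ((1 + x) * delta)) * (1 + K * z) <= (1 + 2 * (E * z)) * (1 + K * z).
  by apply: ler_wpM2r; lra.
apply: (le_trans H1).
have H2 : E * z * (K * z) <= 2 * (E * (K * z)) by nra.
lra.
Qed.
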